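(* Let $d\ge1$ and $n\ge1$ be integers. Consider the polynomial differential system $$\dot x=-y+\varepsilon P_a(x,y,z),\qquad \dot y=x+\varepsilon P_b(x,y,z),\qquad \dot z_\ell=\varepsilon P_{c_\ell}(x,y,z)\quad(\ell=1,\dots,d),$$ with $(x,y,z)\in\mathbb{R}\times\mathbb{R}\times\mathbb{R}^d$, where $P_a=\sum a_{ijk}x^iy^jz^k$, $P_b=\sum b_{ijk}x^iy^jz^k$ and $P_{c_1},\dots,P_{c_d}$ are real polynomials of degree at most $n$, and suppose additionally that $a_{00k}=b_{00k}=0$ for all multi-indices $k$. Then the limit cycles obtained by the averaging theory of first order, in the maximum number $n^d(n-1)/2$, can be chosen as close to the origin of $\mathbb{R}^{d+2}$ as we want. Explicitly: for every $\delta>0$ there exist real polynomials $P_a,P_b,P_{c_1},\dots,P_{c_d}$ of degree at most $n$ with $a_{00k}=b_{00k}=0$ for all $k$ such that the averaged function $f$ defined in the context has $n^d(n-1)/2$ simple zeros in $(0,\infty)\times\mathbb{R}^d$ and, for all $\varepsilon\neq0$ with $|\varepsilon|$ sufficiently small, the system has $n^d(n-1)/2$ distinct limit cycles associated with these zeros, all contained in the ball of radius $\delta$ centered at the origin of $\mathbb{R}^{d+2}$.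
   Context: Here $k=(k_1,\dots,k_d)$ is a multi-index, $z^k=z_1^{k_1}\cdots z_d^{k_d}$, and the sums run over all $i,j,k$ with $i+j+k_1+\dots+k_d\le n$; $a_{00k}$ and $b_{00k}$ are the coefficients of the monomials $z^k$ not involving $x,y$. A limit cycle is a periodic orbit that is isolated in the set of all periodic orbits of the system. For $\varepsilon=0$ the non-equilibrium orbits are the periodic orbits $\{x^2+y^2=r^2,\ z=\text{const}\}$, $r>0$. Averaged function of first order: in the coordinates $x=r\cos\theta$, $y=r\sin\theta$, $z=z$ with $r>0$, taking $\theta$ as the new independent variable, the system becomes $r'=\varepsilon F_1(\theta,r,z)+O(\varepsilon^2)$, $z_\ell'=\varepsilon F_{\ell+1}(\theta,r,z)+O(\varepsilon^2)$, where $$F_1(\theta,r,z)=\cos\theta\,P_a(r\cos\theta,r\sin\theta,z)+\sin\theta\,P_b(r\cos\theta,r\sin\theta,z),$$ $$F_{\ell+1}(\theta,r,z)=P_{c_\ell}(r\cos\theta,r\sin\theta,z),\quad \ell=1,\dots,d.$$ The averaged function is $f=(f_1,\dots,f_{d+1})$ with $f_m(r,z)=\int_0^{2\pi}F_m(\theta,r,z)\,d\theta$. A zero of $f$ is simple if the Jacobian determinant of $f$ there is nonzero. The limit cycle associated with a simple zero $(r^*,z^* )$, $r^*>0$, is one that converges as $\varepsilon\to0$ to the periodic orbit $\{x^2+y^2=(r^* )^2,\ z=z^*\}$ of the unperturbed system. *)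

(* Defs.v *)
From HB Require Import structures.
From mathcomp Require Import all_boot all_order all_algebra.
From mathcomp Require Import all_classical all_reals all_analysis.
(* The notations of mpoly clash with those of MathComp-Analysis; only its
   constants and canonical instances are imported. *)
From mathcomp Require Import -(notations) mpoly.

Set Implicit Arguments.
Unset Strict Implicit.
Unset Printing Implicit Defensive.

Import Order.TTheory GRing.Theory Num.Theory.
Import numFieldNormedType.Exports.

Local Open Scope classical_set_scope.
Local Open Scope ring_scope.

(* A point (x, y, z_1, ..., z_d) of R^(d+2) is a row vector of size d.+2 with
   coordinates in this order; the variables of the polynomials are numbered
   in the same way. *)

Definition ix (d : nat) : 'I_d.+2 := ord0.
Definition iy (d : nat) : 'I_d.+2 := lift ord0 ord0.
Definition iz (d : nat) (l : 'I_d) : 'I_d.+2 := lift ord0 (lift ord0 l).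

Definition pt (R : realType) (d : nat) (x y : R) (z : 'rV[R]_d) : 'rV[R]_d.+2 :=
  row_mx x%:M (row_mx y%:M z).

Definition peval (R : realType) (m : nat) (P : mpoly m R) (u : 'rV[R]_m) : R :=
  meval (fun i => u 0 i) P.

(* [mpoly.msize P] is 1 + the degree of P, and 0 for P = 0. *)
Definition deg_le (R : realType) (m n : nat) (P : mpoly m R) : Prop :=
  (mpoly.msize P <= n.+1)%N.

Definition no_pure_z (R : realType) (d : nat) (P : mpoly d.+2 R) : Prop :=
  forall m : multinom d.+2, m (ix d) = 0%N -> m (iy d) = 0%N -> mcoeff m P = 0.

Record polysys (R : realType) (d : nat) := PolySys {
  Pa : mpoly d.+2 R;
  Pb : mpoly d.+2 R;
  Pc : 'I_d -> mpoly d.+2 R }.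

Definition vfield (R : realType) (d : nat) (S : polysys R d) (eps : R)
    (u : 'rV[R]_d.+2) : 'rV[R]_d.+2 :=
  pt (- u 0 (iy d) + eps * peval (Pa S) u)
     (u 0 (ix d) + eps * peval (Pb S) u)
     (\row_(l < d) (eps * peval (Pc S l) u)).

(* [G] is the image of a nonconstant periodic solution of u' = V(u). *)
Definition periodic_orbit (R : realType) (m : nat)
    (V : 'rV[R]_m.+1 -> 'rV[R]_m.+1) (G : set 'rV[R]_m.+1) : Prop :=
  exists (phi : R -> 'rV[R]_m.+1) (T : R),
    [/\ 0 < T,
        forall t : R, is_derive t 1 phi (V (phi t)),
        forall t : R, phi (t + T) = phi t,
        exists t : R, phi t <> phi 0
      & G = range phi].

(* [G] is isolated among the periodic orbits: some neighbourhood of [G]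
   contains no other periodic orbit. *)
Definition limit_cycle (R : realType) (m : nat)
    (V : 'rV[R]_m.+1 -> 'rV[R]_m.+1) (G : set 'rV[R]_m.+1) : Prop :=
  periodic_orbit V G /\
  exists U : set 'rV[R]_m.+1,
    [/\ open U, G `<=` U
      & forall G', periodic_orbit V G' -> G' `<=` U -> G' = G].

Definition cyl (R : realType) (d : nat) (theta r : R) (z : 'rV[R]_d) :=
  pt (r * cos theta) (r * sin theta) z.

Definition F_r (R : realType) (d : nat) (S : polysys R d) (theta r : R)
    (z : 'rV[R]_d) : R :=
  cos theta * peval (Pa S) (cyl theta r z)
  + sin theta * peval (Pb S) (cyl theta r z).

Definition F_z (R : realType) (d : nat) (S : polysys R d) (l : 'I_d)
    (theta r : R) (z : 'rV[R]_d) : R :=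
  peval (Pc S l) (cyl theta r z).

(* A point (r, z) of R^(1+d) is a row vector of size d.+1. *)
Definition rcoord (R : realType) (d : nat) (p : 'rV[R]_d.+1) : R := p 0 ord0.
Definition zcoord (R : realType) (d : nat) (p : 'rV[R]_d.+1) : 'rV[R]_d :=
  \row_(l < d) p 0 (lift ord0 l).

Definition averaged (R : realType) (d : nat) (S : polysys R d)
    (p : 'rV[R]_d.+1) : 'rV[R]_d.+1 :=
  row_mx
    (\int[lebesgue_measure]_(theta in `[0, 2 * pi])
        F_r S theta (rcoord p) (zcoord p))%R%:M
    (\row_(l < d) \int[lebesgue_measure]_(theta in `[0, 2 * pi])
        F_z S l theta (rcoord p) (zcoord p))%R.

Definition simple_zero (R : realType) (m : nat)
    (f : 'rV[R]_m.+1 -> 'rV[R]_m.+1) (p : 'rV[R]_m.+1) : Prop :=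
  f p = 0 /\ \det (jacobian f p) != 0.

(* The periodic orbit of the unperturbed system given by p = (r, z), r > 0. *)
Definition circle_of (R : realType) (d : nat) (p : 'rV[R]_d.+1) :
    set 'rV[R]_d.+2 :=
  [set u | u 0 (ix d) ^+ 2 + u 0 (iy d) ^+ 2 = rcoord p ^+ 2 /\
           forall l : 'I_d, u 0 (iz l) = zcoord p 0 l].

(* Each of A, B lies in the eta-neighbourhood of the other, as for the
   Hausdorff distance; `|_| is the maximum norm, which gives the same
   convergence as the Euclidean norm. *)
Definition hausdorff_close (R : realType) (m : nat) (eta : R)
    (A B : set 'rV[R]_m.+1) : Prop :=
  (forall a, A a -> exists2 b, B b & `|a - b| < eta) /\
  (forall b, B b -> exists2 a, A a & `|a - b| < eta).

Definition orbits_cvg0 (R : realType) (m : nat) (G : R -> set 'rV[R]_m.+1)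
    (C : set 'rV[R]_m.+1) : Prop :=
  forall eta : R, 0 < eta -> \forall eps \near 0^', hausdorff_close eta (G eps) C.

(* Meant for delta > 0. *)
Definition euclid_ball0 (R : realType) (m : nat) (delta : R) : set 'rV[R]_m :=
  [set u | \sum_(i < m) u 0 i ^+ 2 < delta ^+ 2].

(* n^d (n - 1) / 2; the division is exact as soon as d >= 1. *)
Definition ncycles (d n : nat) : nat := ((n ^ d * n.-1) %/ 2)%N.

(* Main.v *)
Require Import Defs.
From HB Require Import structures.
From mathcomp Require Import all_boot all_order all_algebra.
From mathcomp Require Import all_classical all_reals all_analysis.
From mathcomp Require Import -(notations) mpoly.
From mathcomp Require Import ring lra zify.

(** The polynomials may be chosen, and the idea is to choose them so that the
    limit cycles are exact circles for every eps and nothing has to be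
    perturbed. Take P_a = x g and P_b = y g, with g and all P_c functions of
    s = x^2 + y^2 and z only. Then the angular speed is 1, the averaged function
    is 2 pi (r g, c) (lemmas [averaged_r], [averaged_z]), and s and z satisfy
    the autonomous system s' = 2 eps s g, z' = eps c. Each zero of the averaged
    function with r > 0 is an equilibrium of that system, so its circle is a
    periodic orbit for every eps, and the claims about the limit eps -> 0 hold
    trivially. Three things remain: to have enough simple zeros, to show that
    their circles are isolated among the periodic orbits, and to make everything
    small.

    Zeros. With weight 2 for s and weight 1 for z the polynomial g may have
    weight n - 1 and each c weight n. In the plane of s and one coordinate z,
    g is a product of lines s = s_i, times z - k when n is even, and h is a
    product of parabolas z^2 + s = rho, times z when n is odd. If every s_i lies
    below every rho and k is small this gives n (n - 1) / 2 zeros, and h and g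
    factor explicitly at each of them. The other d - 1 coordinates get one
    polynomial each in their own variable, with n simple roots, which multiplies
    the count by n^(d-1). Simplicity of the zeros follows from the product rule
    ([nondegenerate_simple]).

    Isolation. A function that is monotone along a periodic solution is constant
    ([periodic_monotone_derive0]). Near each circle there is a quadratic function
    of the deviation from the zero in (s, z) whose derivative along the system is
    definite ([periodic_linear_eq0], [periodic_planar_eq0]); hence a periodic
    orbit that stays nearby has zero deviation, and it is the circle
    ([nondegenerate_limit_cycle]). This needs equilibria whose linear part is
    invertible and not a center, which is why k is not 0.

    Size. All parameters are taken proportional to one small number
    ([small_parameters]). *)

Set Implicit Arguments.
Unset Strict Implicit.
Unset Printing Implicit Defensive.

Import Order.TTheory GRing.Theory Num.Theory.
Import numFieldNormedType.Exports.

Local Open Scope classical_set_scope.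
Local Open Scope ring_scope.

(** * Polynomial functions on row vectors *)

Section PolynomialFunctions.
Variables (R : realType) (m : nat).
Implicit Types (P Q : mpoly m R) (u : 'rV[R]_m).

Definition var (i : 'I_m) : mpoly m R := mpolyX R (mnm1 i).
Definition cstp (c : R) : mpoly m R := mpolyC m c.

Lemma pevalD P Q u : peval (P + Q) u = peval P u + peval Q u.
Proof. exact: mevalD. Qed.

Lemma pevalB P Q u : peval (P - Q) u = peval P u - peval Q u.
Proof. exact: mevalB. Qed.

Lemma pevalM P Q u : peval (P * Q) u = peval P u * peval Q u.
Proof. exact: mevalM. Qed.

Lemma peval1 u : peval 1 u = 1.
Proof. exact: meval1. Qed.

Lemma pevalXn P k u : peval (P ^+ k) u = peval P u ^+ k.
Proof. by rewrite /peval rmorphXn. Qed.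

Lemma peval_var i u : peval (var i) u = u 0 i.
Proof. exact: mevalXU. Qed.

Lemma peval_cst c u : peval (cstp c) u = c.
Proof. exact: mevalC. Qed.

Lemma peval_prod (I : Type) (r : seq I) (p : pred I) (F : I -> mpoly m R) u :
  peval (\prod_(i <- r | p i) F i) u = \prod_(i <- r | p i) peval (F i) u.
Proof. by rewrite /peval rmorph_prod. Qed.

Definition pevalE :=
  (peval_prod, pevalB, pevalD, pevalM, pevalXn, peval1, peval_var, peval_cst).

Lemma differentiable_peval P u : differentiable (peval P) u.
Proof.
elim/mpolyind: P => [|c k P _ _ dP].
  rewrite (_ : peval 0 = cst 0) //; last first.
    by apply/funext => v; rewrite /peval meval0.
have -> : peval (c *: mpolyX R k + P) =
    c *: (\prod_(i < m) (fun v : 'rV[R]_m => v 0 i) ^+ k i) + peval P.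
  apply/funext => v; rewrite pevalD /peval mevalZ mevalX /=.
  by congr (_ * _ + _); rewrite fct_prodE; apply: eq_bigr => i _; rewrite exprfctE.
apply: differentiableD => //; apply: differentiableZ.
elim/big_ind: _ => //.
- by move=> f f' df df'; apply: differentiableM.
- move=> i _; case: (k i) => [|e]; first by rewrite expr0.
  by apply: differentiableX; exact: differentiable_coord.
Qed.

Lemma continuous_peval P : continuous (peval P).
Proof. by move=> u; apply/differentiable_continuous/differentiable_peval. Qed.

Lemma open_peval_gt0 (I : finType) (W : I -> mpoly m R) :
  open [set u | forall i, 0 < peval (W i) u].
Proof.
rewrite openE => u Wu; apply: (filter_forall (F := nbhs u)) => i.
by apply: (cvgr_gt (peval (W i) u)); [exact: continuous_peval|exact: Wu].
Qed.

(** * Degree bounds *)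

Lemma deg_le_cst k c : deg_le k (cstp c).
Proof. by rewrite /deg_le mmeasureC; case: (c == 0). Qed.

Lemma deg_le_var i : deg_le 1 (var i).
Proof. by rewrite /deg_le /var msizeX mdeg1. Qed.

Lemma deg_leS k l P : (k <= l)%N -> deg_le k P -> deg_le l P.
Proof. by move=> kl /leq_trans; apply. Qed.

Lemma deg_leD k P Q : deg_le k P -> deg_le k Q -> deg_le k (P + Q).
Proof.
by move=> Pk Qk; apply: leq_trans (mmeasureD_le _ _ _) _; rewrite geq_max Pk Qk.
Qed.

Lemma deg_leB k P Q : deg_le k P -> deg_le k Q -> deg_le k (P - Q).
Proof.
by move=> Pk Qk; apply: deg_leD => //; rewrite /deg_le mmeasureN.
Qed.

Lemma deg_leM k l P Q : deg_le k P -> deg_le l Q -> deg_le (k + l) (P * Q).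
Proof.
rewrite /deg_le; have [->|P0] := eqVneq P 0; first by rewrite mul0r mmeasure0.
have [->|Q0] := eqVneq Q 0; first by rewrite mulr0 mmeasure0.
move=> Pk Ql; rewrite msizeM //.
move: P0 Pk; rewrite -(mmeasure_poly_eq0 mdeg) -lt0n => P0 Pk.
by rewrite -ltnS prednK ?(ltn_addr _ P0)// -addnS -addSn leq_add.
Qed.

Lemma deg_le_sqr k P : deg_le k P -> deg_le (k + k) (P ^+ 2).
Proof. by move=> Pk; rewrite expr2; apply: deg_leM. Qed.

Lemma deg_le_prod (I : Type) (r : seq I) (F : I -> mpoly m R) k :
  (forall i, deg_le k (F i)) -> deg_le (size r * k) (\prod_(i <- r) F i).
Proof.
move=> Fk; elim: r => [|i r IH]; first by rewrite big_nil; exact: deg_le_cst.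
by rewrite big_cons mulSn; exact: deg_leM.
Qed.

End PolynomialFunctions.

(** * Periodic solutions with a monotone function *)

Section PeriodicSolutions.
Variables (R : realType) (T : R).
Hypothesis T_gt0 : 0 < T.

(** For x <= y <= x + kT a nondecreasing V satisfies
    V x <= V y <= V (x + kT) = V x, so it is constant. *)
Lemma periodic_monotone_derive0 (V W : R -> R) :
  (forall t : R, is_derive t 1 V (W t)) -> (forall t, 0 <= W t) ->
  periodic V T -> forall t, W t = 0.
Proof.
move=> dV W0 VT t.
have Vmono x y : x <= y -> V x <= V y.
  move=> xy; apply: (@ger0_derive1_ndecr _ V x y) => //.
  - by move=> s _; rewrite derive1E; have [_ ->] := dV s.
  - apply: continuous_subspaceT => s; apply: differentiable_continuous.
    by apply/derivable1_diffP; case: (dV s).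
have Vcst x y : x <= y -> V x = V y.
  move=> xy; apply/eqP; rewrite eq_le Vmono //=.
  pose k := Num.truncn ((y - x) / T).
  have : y <= x + T *+ k.+1.
    rewrite -lerBlDl -mulr_natr mulrC -ler_pdivrMr //.
    by apply/ltW/truncnS_gt.
  by move=> /Vmono; rewrite (periodicn VT).
have VC : V = cst (V t).
  by apply/funext => s; case: (leP s t) => [|/ltW] /Vcst ->.
have [_ <-] := dV t.
by rewrite VC derive_cst.
Qed.

(** The derivative of sigma w^2 is 2 sigma k w^2, positive wherever w is not
    zero. *)
Lemma periodic_linear_eq0 (sigma : R) (k w : R -> R) :
  (forall t, 0 < sigma * k t) -> (forall t : R, is_derive t 1 w (k t * w t)) ->
  periodic w T -> forall t, w t = 0.
Proof.
move=> k0 dw wT t.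
pose V := sigma *: (w ^+ 2) : R -> R.
have dV (s : R) : is_derive s 1 V (2 * (sigma * k s * w s ^+ 2)).
  apply: is_derive_eq; rewrite /GRing.scale /=; ring.
have W0 s : 0 <= 2 * (sigma * k s * w s ^+ 2).
  by rewrite mulr_ge0 // mulr_ge0 ?sqr_ge0 // ltW.
have VT : periodic V T by move=> s; rewrite /V /= !fctE wT.
have /eqP := periodic_monotone_derive0 dV W0 VT t.
rewrite mulf_eq0 pnatr_eq0 /= mulf_eq0 gt_eqF //= sqrf_eq0.
by move/eqP.
Qed.

(** The quadratic function V = a u^2 + u v + e v^2 satisfies
    V' = eps (N u^2 + B u v + C v^2) with B = 2 a K + M + 2 e N and
    C = K + 2 e M. When K, N, M take the values k0, n0, m0 the choice of a makes
    B vanish and that of e makes N C = 1, so V' is a definite form there, and it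
    remains definite as long as 4 N C - B^2 > 0. The form V itself may be
    indefinite, which is why saddles, nodes and foci need no separate treatment.
    For m0 = 0, a linear part of trace 0, no e gives N C = 1: that is the case
    of centers. *)
Lemma periodic_planar_eq0 (eps k0 n0 m0 : R) (K N M u v : R -> R)
    (e := (n0^-1 - k0) / (2 * m0)) (a := - (m0 + 2 * e * n0) / (2 * k0)) :
  eps != 0 -> n0 != 0 ->
  (forall t, 0 < n0 * N t) ->
  (forall t, 0 < 4 * N t * (K t + 2 * e * M t)
                 - (2 * a * K t + M t + 2 * e * N t) ^+ 2) ->
  (forall t : R, is_derive t 1 u (eps * (K t * v t))) ->
  (forall t : R, is_derive t 1 v (eps * (N t * u t + M t * v t))) ->
  periodic u T -> periodic v T -> forall t, u t = 0 /\ v t = 0.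
Proof.
move=> eps0 n00 N0 D0 du dv uT vT t.
pose B s := 2 * a * K s + M s + 2 * e * N s.
pose C s := K s + 2 * e * M s.
pose Q s := N s * u s ^+ 2 + B s * (u s * v s) + C s * v s ^+ 2.
pose V := (eps * n0) *: (a *: (u ^+ 2) + u * v + e *: (v ^+ 2)) : R -> R.
have dV (s : R) : is_derive s 1 V (eps ^+ 2 * (n0 * Q s)).
  have dVs := is_deriveZ (eps * n0) (is_deriveD (is_deriveD
    (is_deriveZ a (is_deriveX 2 (du s))) (is_deriveM (du s) (dv s)))
    (is_deriveZ e (is_deriveX 2 (dv s)))).
  apply: (is_derive_eq dVs); rewrite /GRing.scale /= /Q /B /C; ring.
(* Completing the square shows that Q has the sign of N. *)
have sq s : 4 * N s * Q s = (2 * N s * u s + B s * v s) ^+ 2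
                          + (4 * N s * C s - B s ^+ 2) * v s ^+ 2.
  by rewrite /Q; ring.
have nQ s : (n0 * Q s) * (4 * (n0 * N s)) = n0 ^+ 2 * (4 * N s * Q s) by ring.
have n4 s : 0 < 4 * (n0 * N s) by rewrite mulr_gt0.
have Q0 s : 0 <= n0 * Q s.
  rewrite -(pmulr_lge0 _ (n4 s)) nQ mulr_ge0 ?sqr_ge0 // sq.
  by rewrite addr_ge0 ?sqr_ge0 // mulr_ge0 ?sqr_ge0 // ltW // D0.
have VT : periodic V T by move=> s; rewrite /V /= !fctE uT vT.
have W0 s : 0 <= eps ^+ 2 * (n0 * Q s) by rewrite mulr_ge0 ?sqr_ge0.
have /eqP := periodic_monotone_derive0 dV W0 VT t.
rewrite mulf_eq0 sqrf_eq0 (negPf eps0) mulf_eq0 (negPf n00) /= => /eqP Qt.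
have /eqP := sq t; rewrite Qt mulr0 eq_sym paddr_eq0 ?sqr_ge0 //; last first.
  by rewrite mulr_ge0 ?sqr_ge0 // ltW // D0.
rewrite sqrf_eq0 mulf_eq0 sqrf_eq0 => /andP[+ /orP[]].
  by move=> _; rewrite gt_eqF // D0.
move=> + /eqP vt; rewrite vt mulr0 addr0 !mulf_eq0 pnatr_eq0 /=.
have /gt_eqF := N0 t; rewrite mulf_eq0 => /norP[_ /negPf ->] /= /eqP.
by split.
Qed.

End PeriodicSolutions.

(** * Radial polynomials and radial systems *)

Section Coordinates.
Variables (R : realType) (d : nat).
Implicit Types (P Q : mpoly d.+2 R) (u v : 'rV[R]_d.+2) (z : 'rV[R]_d).

Lemma pt_ix x y z : pt x y z 0 (ix d) = x.
Proof.
have -> : ix d = lshift d.+1 (ord0 : 'I_1) by apply/val_inj.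
by apply: (etrans (row_mxEl _ _ 0 (ord0 : 'I_1))); rewrite mxE.
Qed.

Lemma pt_iy x y z : pt x y z 0 (iy d) = y.
Proof.
have -> : iy d = rshift 1 (lshift d (ord0 : 'I_1)) by apply/val_inj.
by do 2![apply: (etrans (row_mxEr _ _ 0 _)) || apply: (etrans (row_mxEl _ _ 0 _))];
  rewrite mxE.
Qed.

Lemma pt_iz x y z l : pt x y z 0 (iz l) = z 0 l.
Proof.
have -> : iz l = rshift 1 (rshift 1 l) by apply/val_inj.
by apply: (etrans (row_mxEr _ _ 0 _)); apply: row_mxEr.
Qed.

Lemma coordP (Pr : 'I_d.+2 -> Prop) :
  Pr (ix d) -> Pr (iy d) -> (forall l, Pr (iz l)) -> forall i, Pr i.
Proof.
move=> Px Py Pz i; have [j ->|->] := unliftP ord0 i; last exact: Px.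
by have [l ->|->] := unliftP ord0 j; [exact: Pz|exact: Py].
Qed.

Lemma row_ext u v : u 0 (ix d) = v 0 (ix d) -> u 0 (iy d) = v 0 (iy d) ->
  (forall l, u 0 (iz l) = v 0 (iz l)) -> u = v.
Proof. by move=> ex ey ez; apply/rowP; apply: coordP. Qed.

Definition rad2 : mpoly d.+2 R := var R (ix d) ^+ 2 + var R (iy d) ^+ 2.

Lemma peval_rad2 u : peval rad2 u = u 0 (ix d) ^+ 2 + u 0 (iy d) ^+ 2.
Proof. by rewrite /rad2 !pevalE. Qed.

(** Invariance under the rotations of the (x, y)-plane. *)
Definition radial P := forall u v, peval rad2 u = peval rad2 v ->
  (forall l, u 0 (iz l) = v 0 (iz l)) -> peval P u = peval P v.

Lemma radial_rad2 : radial rad2. Proof. by []. Qed.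

Lemma radial_z l : radial (var R (iz l)).
Proof. by move=> u v _ uv; rewrite !pevalE. Qed.

Lemma radial_cst c : radial (cstp d.+2 c).
Proof. by move=> u v _ _; rewrite !pevalE. Qed.

Lemma radialD P Q : radial P -> radial Q -> radial (P + Q).
Proof. by move=> rP rQ u v s l; rewrite !pevalE (rP _ _ s l) (rQ _ _ s l). Qed.

Lemma radialB P Q : radial P -> radial Q -> radial (P - Q).
Proof. by move=> rP rQ u v s l; rewrite !pevalE (rP _ _ s l) (rQ _ _ s l). Qed.

Lemma radialM P Q : radial P -> radial Q -> radial (P * Q).
Proof. by move=> rP rQ u v s l; rewrite !pevalE (rP _ _ s l) (rQ _ _ s l). Qed.

Lemma radialX P k : radial P -> radial (P ^+ k).
Proof. by move=> rP u v s l; rewrite !pevalE (rP _ _ s l). Qed.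

Lemma radial_prod (I : Type) (r : seq I) (p : pred I) (F : I -> mpoly d.+2 R) :
  (forall i, radial (F i)) -> radial (\prod_(i <- r | p i) F i).
Proof.
move=> rF; elim/big_ind: _ => //; first exact: radial_cst 1.
exact: radialM.
Qed.

(** The point where the orbit with radius r and height z crosses the
    half-plane y = 0, x > 0: radial polynomials are determined there. *)
Definition base (p : 'rV[R]_d.+1) : 'rV[R]_d.+2 := pt (rcoord p) 0 (zcoord p).

Lemma base_iz (p : 'rV[R]_d.+1) l : base p 0 (iz l) = p 0 (lift ord0 l).
Proof. by rewrite pt_iz mxE. Qed.

Lemma rad2_base p : peval rad2 (base p) = rcoord p ^+ 2.
Proof. by rewrite peval_rad2 pt_ix pt_iy expr0n addr0. Qed.

Lemma circle_ofP p u : circle_of p u <->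
  peval rad2 u = peval rad2 (base p) /\ forall l, u 0 (iz l) = base p 0 (iz l).
Proof.
rewrite peval_rad2 rad2_base /circle_of /=.
by split=> -[-> uz]; split=> // l; rewrite uz ?pt_iz.
Qed.

Lemma radial_circle P p u : radial P -> circle_of p u ->
  peval P u = peval P (base p).
Proof. by move=> rP /circle_ofP[s l]; apply: rP. Qed.

Lemma circle_cyl (p : 'rV[R]_d.+1) theta :
  circle_of p (cyl theta (rcoord p) (zcoord p)).
Proof.
split=> [|l]; last by rewrite pt_iz.
by rewrite pt_ix pt_iy !exprMn -mulrDr cos2Dsin2 mulr1.
Qed.

Lemma polar (x y r : R) : 0 < r -> x ^+ 2 + y ^+ 2 = r ^+ 2 ->
  exists theta, x = r * cos theta /\ y = r * sin theta.
Proof.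
move=> r0 xy.
have h : -1 <= x / r <= 1.
  rewrite -ler_norml -(@expr_le1 _ 2) // real_normK ?num_real // expr_div_n.
  by rewrite ler_pdivrMr ?exprn_gt0 // mul1r -xy lerDl sqr_ge0.
have hc : r * cos (acos (x / r)) = x.
  by rewrite acosK // mulrC divfK // gt_eqF.
have hs : r * sin (acos (x / r)) = `|y|.
  rewrite sin_acos // -{1}(gtr0_norm r0) -sqrtr_sqr -sqrtrM ?sqr_ge0 //.
  rewrite mulrBr mulr1 expr_div_n mulrC divfK ?expf_neq0 ?gt_eqF //.
  by rewrite -xy addrC addKr sqrtr_sqr.
have [y0|y0] := leP 0 y.
  by exists (acos (x / r)); rewrite hc hs ger0_norm.
by exists (- acos (x / r)); rewrite cosN sinN mulrN hc hs ltr0_norm ?opprK.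
Qed.

Lemma circle_inj (p q : 'rV[R]_d.+1) : 0 < rcoord p -> 0 < rcoord q ->
  circle_of p = circle_of q -> p = q.
Proof.
move=> p0 q0 epq; have : circle_of q (base p).
  by rewrite -epq; apply/circle_ofP.
case=> [+ zpq]; rewrite pt_ix pt_iy expr0n addr0 => /eqP.
rewrite eqrXn2 ?ltW // => /eqP rpq.
apply/rowP => i; have [l ->|->] := unliftP ord0 i; last exact: rpq.
by have := zpq l; rewrite pt_iz !mxE.
Qed.

(** The vector fields x' = -y + eps x g, y' = x + eps y g, z_l' = eps c_l: the
    angular speed is 1, and for radial g and c_l the radius and z evolve by
    themselves. *)
Definition radial_sys (g : mpoly d.+2 R) (c : 'I_d -> mpoly d.+2 R) :=
  PolySys (var R (ix d) * g) (var R (iy d) * g) c.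

Lemma no_pure_z_var_mul i g : i = ix d \/ i = iy d -> no_pure_z (var R i * g).
Proof.
move=> ixy m mx my; apply/eqP; rewrite mcoeff_eq0; apply/negP.
rewrite mulrC (perm_mem (msuppMX _ _)) => /mapP[k _ mk].
have : m i <> 0%N by rewrite mk mnmDE mnm1E eqxx.
by case: ixy => ->.
Qed.

End Coordinates.

(** * The averaged function of a radial system *)

Lemma differentiable_rowP (R : realType) (V : normedModType R) (n : nat)
    (f : V -> 'rV[R]_n) (x : V) :
  (forall j, differentiable (fun v => f v 0 j) x) -> differentiable f x.
Proof.
move=> df.
rewrite (_ : f = \sum_(j < n) (fun v => f v 0 j *: delta_mx 0 j)); last first.
  by apply/funext => v; rewrite fct_sumE -row_sum_delta.
by apply: differentiable_sum => j; apply: differentiableZl.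
Qed.

Section AveragedRadial.
Variables (R : realType) (d : nat).
Variables (g : mpoly d.+2 R) (c : 'I_d -> mpoly d.+2 R).
Hypotheses (rg : radial g) (rc : forall l, radial (c l)).
Implicit Types p v : 'rV[R]_d.+1.

Let f : 'rV[R]_d.+1 -> 'rV[R]_d.+1 := averaged (radial_sys g c).

Lemma Rintegral_circle_cst (k : R) :
  (\int[lebesgue_measure]_(theta in `[0%R, 2 * pi]) k)%R = k * (2 * pi).
Proof.
rewrite Rintegral_cst //= lebesgue_measure_itv /= lte_fin.
by rewrite mulr_gt0 ?pi_gt0 //= subr0.
Qed.

(** For a radial system cos^2 + sin^2 = 1 removes theta from the integrand, so
    that averaging only multiplies by 2 pi. *)
Lemma averaged_r p :
  f p 0 ord0 = rcoord p * peval g (base p) * (2 * pi).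
Proof.
rewrite -Rintegral_circle_cst.
have -> : ord0 = lshift d (ord0 : 'I_1) by apply/val_inj.
apply: (etrans (row_mxEl _ _ 0 (ord0 : 'I_1))); rewrite mxE eqxx mulr1n.
congr (Rintegral _ _ _); apply/funext => theta.
rewrite /F_r /= !pevalE (radial_circle rg (circle_cyl p theta)) pt_ix pt_iy.
rewrite -[RHS]mul1r -(cos2Dsin2 theta); ring.
Qed.

Lemma averaged_z p l :
  f p 0 (lift ord0 l) = peval (c l) (base p) * (2 * pi).
Proof.
rewrite -Rintegral_circle_cst.
have -> : lift ord0 l = rshift 1 l by apply/val_inj.
apply: (etrans (row_mxEr _ _ 0 l)); rewrite mxE.
congr (Rintegral _ _ _); apply/funext => theta.
by rewrite /F_z /= (radial_circle (rc l) (circle_cyl p theta)).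
Qed.

Lemma twopi_neq0 : 2 * pi != 0 :> R.
Proof. by rewrite gt_eqF // mulr_gt0 // pi_gt0. Qed.

Lemma averaged_eq0 p : 0 < rcoord p ->
  f p = 0 <-> peval g (base p) = 0 /\ forall l, peval (c l) (base p) = 0.
Proof.
move=> p0; split=> [fp|[g0 c0]].
  split=> [|l].
    have /eqP := averaged_r p; rewrite fp mxE eq_sym mulf_eq0.
    by rewrite (negPf twopi_neq0) orbF mulf_eq0 (gt_eqF p0) => /eqP.
  have /eqP := averaged_z p l; rewrite fp mxE eq_sym mulf_eq0.
  by rewrite (negPf twopi_neq0) orbF => /eqP.
apply/rowP => i; rewrite [RHS]mxE; have [l ->|->] := unliftP ord0 i.
  by rewrite averaged_z c0 mul0r.
by rewrite averaged_r g0 mulr0 mul0r.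
Qed.

Lemma differentiable_base p : differentiable (@base R d) p.
Proof.
apply: differentiable_rowP; apply: coordP => [||l].
- rewrite (_ : (fun _ => _) = fun q : 'rV[R]_d.+1 => q 0 ord0).
    exact: differentiable_coord.
  by apply/funext => q; rewrite pt_ix.
- rewrite (_ : (fun _ => _) = cst 0) //.
  by apply/funext => q; rewrite pt_iy.
- rewrite (_ : (fun _ => _) = fun q : 'rV[R]_d.+1 => q 0 (lift ord0 l)).
    exact: differentiable_coord.
  by apply/funext => q; rewrite base_iz.
Qed.

Lemma differentiable_peval_base P p :
  differentiable (fun q => peval P (base q)) p.
Proof.
apply: (differentiable_comp (differentiable_base p)).
exact: differentiable_peval.
Qed.

(** The derivative in (r, z), in direction v, of the restriction of P to the
    half-plane y = 0, x > 0. *)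
Definition Dbase p v (P : mpoly d.+2 R) := 'D_v (fun q => peval P (base q)) p.

Lemma DbaseD p v P Q : Dbase p v (P + Q) = Dbase p v P + Dbase p v Q.
Proof.
rewrite /Dbase; set a := (fun q => peval P _); set b := (fun q => peval Q _).
have -> : (fun q => peval (P + Q) (base q)) = a + b.
  by apply/funext => q; apply: pevalD.
by rewrite deriveD //; exact/diff_derivable/differentiable_peval_base.
Qed.

Lemma DbaseM p v P Q : Dbase p v (P * Q) =
  peval P (base p) * Dbase p v Q + peval Q (base p) * Dbase p v P.
Proof.
rewrite /Dbase; set a := (fun q => peval P _); set b := (fun q => peval Q _).
have -> : (fun q => peval (P * Q) (base q)) = a * b.
  by apply/funext => q; apply: pevalM.
by rewrite deriveM //; exact/diff_derivable/differentiable_peval_base.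
Qed.

Lemma Dbase_cst p v k : Dbase p v (cstp d.+2 k) = 0.
Proof.
rewrite /Dbase (_ : (fun q => _) = cst k) ?derive_cst //.
by apply/funext => q; apply: peval_cst.
Qed.

Lemma DbaseB_cst p v P k : Dbase p v (P - cstp d.+2 k) = Dbase p v P.
Proof.
by rewrite -mpolyCN DbaseD Dbase_cst addr0.
Qed.

Lemma derive_coord p v i : 'D_v (fun q : 'rV[R]_d.+1 => q 0 i) p = v 0 i.
Proof.
have dp : derivable (fun q : 'rV[R]_d.+1 => q) p v.
  exact/diff_derivable.
by rewrite -[in RHS](derive_id p v) derive_mx // mxE.
Qed.

Lemma Dbase_z p v l : Dbase p v (var R (iz l)) = v 0 (lift ord0 l).
Proof.
rewrite /Dbase (_ : (fun q => _) = fun q : 'rV[R]_d.+1 => q 0 (lift ord0 l)).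
  exact: derive_coord.
by apply/funext => q; rewrite peval_var base_iz.
Qed.

Lemma Dbase_rad2 p v : Dbase p v (rad2 R d) = 2 * rcoord p * v 0 ord0.
Proof.
have Dx : Dbase p v (var R (ix d)) = v 0 ord0.
  rewrite /Dbase (_ : (fun q => _) = fun q : 'rV[R]_d.+1 => q 0 ord0).
    exact: derive_coord.
  by apply/funext => q; rewrite peval_var pt_ix.
rewrite /rad2 DbaseD !expr2 !DbaseM Dx !peval_var pt_ix pt_iy; ring.
Qed.

(** The Jacobian determinant is nonzero as soon as the Jacobian matrix has a
    trivial kernel, and the kernel is described by directional derivatives, to
    which the product rule applies directly when g and c are given in factored
    form. *)
Lemma averaged_simple_zero p : 0 < rcoord p ->
  peval g (base p) = 0 -> (forall l, peval (c l) (base p) = 0) ->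
  (forall v, Dbase p v g = 0 -> (forall l, Dbase p v (c l) = 0) -> v = 0) ->
  simple_zero f p.
Proof.
move=> p0 g0 c0 ker0.
have fr : (fun q => f q 0 ord0) =
    (2 * pi) *: (fun q => peval (var R (ix d) * g) (base q)).
  apply/funext => q.
  rewrite -[RHS]/(2 * pi * peval (var R (ix d) * g) (base q)).
  by rewrite averaged_r pevalM peval_var pt_ix mulrC.
have fz l : (fun q => f q 0 (lift ord0 l)) =
    (2 * pi) *: (fun q => peval (c l) (base q)).
  apply/funext => q; rewrite -[RHS]/(2 * pi * peval (c l) (base q)).
  by rewrite averaged_z mulrC.
have df : differentiable f p.
  apply: differentiable_rowP => i; have [l ->|->] := unliftP ord0 i.
    by rewrite fz; apply/differentiableZ/differentiable_peval_base.
  by rewrite fr; apply/differentiableZ/differentiable_peval_base.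
split; first exact/averaged_eq0.
rewrite -unitfE -unitmxE -row_free_unit; apply: inj_row_free => v.
rewrite -deriveEjacobian // derive_mx; last exact: diff_derivable.
move=> Dv0; apply: ker0 => [|l].
  have /rowP/(_ ord0) := Dv0; rewrite !mxE fr deriveZ; last first.
    exact/diff_derivable/differentiable_peval_base.
  rewrite -/(Dbase p v _) DbaseM g0 mul0r addr0 peval_var pt_ix => /eqP.
  rewrite scaler_eq0 (negPf twopi_neq0) mulf_eq0 (gt_eqF p0) /=.
  by move/eqP.
have /rowP/(_ (lift ord0 l)) := Dv0; rewrite !mxE fz deriveZ; last first.
  exact/diff_derivable/differentiable_peval_base.
by move/eqP; rewrite scaler_eq0 (negPf twopi_neq0) => /eqP.
Qed.

End AveragedRadial.

(** * Nondegenerate zeros carry isolated circles *)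

Lemma is_derive_rowP (R : realType) (n : nat) (phi : R -> 'rV[R]_n) (t : R)
    (w : 'rV[R]_n) :
  is_derive t 1 phi w <->
  forall j, is_derive t 1 (fun s => phi s 0 j) (w 0 j).
Proof.
split=> [[dphi <-] j|dphi].
  rewrite derive_mx // mxE; apply: derivableP.
  by apply: (iffLR (derivable_mxP phi t 1)).
have dv : derivable phi t 1.
  by apply/derivable_mxP => i j; rewrite (ord1 i); case: (dphi j).
apply: DeriveDef => //; apply/rowP => j; rewrite derive_mx // mxE.
by case: (dphi j).
Qed.

Section Nondegenerate.
Variables (R : realType) (d : nat) (l0 : 'I_d).
Variables (g : mpoly d.+2 R) (c : 'I_d -> mpoly d.+2 R).
Hypotheses (rg : radial g) (rc : forall l, radial (c l)).
Implicit Types p v : 'rV[R]_d.+1.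

Definition rad_at p := rad2 R d - cstp d.+2 (rcoord p ^+ 2).
Definition z_at p l := var R (iz l) - cstp d.+2 (zcoord p 0 l).

(** With u and v the deviations of s = x^2 + y^2 and of the coordinate l0 of z
    from their values at p, this says that near the orbit of p the planar part
    reads g = K u or g = K v and h = N u + M v, while the other z_l evolve by
    themselves. The coefficients K, N, M, Q are functions, not the constants of
    a linear part: exact factorizations leave no remainder to estimate, and only
    the values of the coefficients on the circle have to be nonzero. *)
Record nondegenerate p : Prop := Nondegenerate {
  nd_scalar : exists Q : 'I_d -> mpoly d.+2 R, forall l, l != l0 ->
    [/\ radial (Q l), peval (Q l) (base p) != 0 & c l = Q l * z_at p l];
  nd_planar : exists K N M : mpoly d.+2 R,
    [/\ [/\ radial K, radial N & radial M],
        peval K (base p) != 0, peval M (base p) != 0,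
        c l0 = N * rad_at p + M * z_at p l0
      & g = K * rad_at p \/ g = K * z_at p l0 /\ peval N (base p) != 0] }.

Variable p : 'rV[R]_d.+1.
Hypothesis p_gt0 : 0 < rcoord p.
Hypothesis ndp : nondegenerate p.

Lemma peval_rad_at u : peval (rad_at p) u = peval (rad2 R d) u - rcoord p ^+ 2.
Proof. by rewrite !pevalE. Qed.

Lemma peval_z_at u l : peval (z_at p l) u = u 0 (iz l) - zcoord p 0 l.
Proof. by rewrite !pevalE. Qed.

Lemma rad_at_base : peval (rad_at p) (base p) = 0.
Proof. by rewrite peval_rad_at rad2_base subrr. Qed.

Lemma z_at_base l : peval (z_at p l) (base p) = 0.
Proof. by rewrite peval_z_at base_iz mxE subrr. Qed.

Lemma nondegenerate_zero :
  peval g (base p) = 0 /\ forall l, peval (c l) (base p) = 0.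
Proof.
case: ndp => -[Q hQ] [K [N [M [_ _ _ cl0 hg]]]]; split=> [|l].
  by case: hg => [|[]] ->; rewrite pevalM ?rad_at_base ?z_at_base mulr0.
have [->|/hQ[_ _ ->]] := eqVneq l l0; last by rewrite pevalM z_at_base mulr0.
by rewrite cl0 pevalD !pevalM rad_at_base z_at_base !mulr0 addr0.
Qed.

(** At a zero of w the derivative of K w is K times that of w, so a kernel
    vector is killed coordinate by coordinate, in triangular order. *)
Lemma nondegenerate_simple : simple_zero (averaged (radial_sys g c)) p.
Proof.
have [g0 c0] := nondegenerate_zero.
apply: averaged_simple_zero => // v Dg Dc.
have Drad : Dbase p v (rad_at p) = 2 * rcoord p * v 0 ord0.
  by rewrite DbaseB_cst Dbase_rad2.
have Dz l : Dbase p v (z_at p l) = v 0 (lift ord0 l).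
  by rewrite DbaseB_cst Dbase_z.
case: ndp => -[Q hQ] [K [N [M [_ K0 M0 cl0 hg]]]].
have [Dr Dl0] : v 0 ord0 = 0 /\ v 0 (lift ord0 l0) = 0.
  have := Dc l0; rewrite cl0 DbaseD !DbaseM rad_at_base z_at_base !mul0r !addr0.
  rewrite Drad Dz.
  case: hg Dg => [|[]] -> + => [|N0]; rewrite DbaseM ?rad_at_base ?z_at_base.
    rewrite mul0r addr0 Drad => /eqP.
    rewrite mulf_eq0 (negPf K0) !mulf_eq0 pnatr_eq0 (gt_eqF p_gt0) /= => /eqP vr.
    rewrite vr !mulr0 add0r => /eqP; rewrite mulf_eq0 (negPf M0) /= => /eqP.
    by split.
  rewrite mul0r addr0 Dz => /eqP; rewrite mulf_eq0 (negPf K0) /= => /eqP vz.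
  rewrite vz mulr0 addr0 => /eqP.
  rewrite mulf_eq0 (negPf N0) !mulf_eq0 pnatr_eq0 (gt_eqF p_gt0) /= => /eqP.
  by split.
apply/rowP => i; rewrite mxE; have [l ->|->] := unliftP ord0 i => //.
have [->//|/hQ[_ Q0 cl]] := eqVneq l l0.
have /eqP := Dc l; rewrite cl DbaseM z_at_base mul0r addr0 Dz.
by rewrite mulf_eq0 (negPf Q0) /= => /eqP.
Qed.

Section Orbit.
Variables (eps T : R) (phi : R -> 'rV[R]_d.+2).
Hypothesis dphi : forall t : R,
  is_derive t 1 phi (vfield (radial_sys g c) eps (phi t)).

Lemma orbit_x (t : R) : is_derive t 1 (fun s => phi s 0 (ix d))
  (- phi t 0 (iy d) + eps * (phi t 0 (ix d) * peval g (phi t))).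
Proof.
have /is_derive_rowP/(_ (ix d)) := dphi t.
by rewrite pt_ix pevalM peval_var.
Qed.

Lemma orbit_y (t : R) : is_derive t 1 (fun s => phi s 0 (iy d))
  (phi t 0 (ix d) + eps * (phi t 0 (iy d) * peval g (phi t))).
Proof.
have /is_derive_rowP/(_ (iy d)) := dphi t.
by rewrite pt_iy pevalM peval_var.
Qed.

Lemma orbit_z (t : R) l : is_derive t 1 (fun s => peval (z_at p l) (phi s))
  (eps * peval (c l) (phi t)).
Proof.
have /is_derive_rowP/(_ (iz l)) := dphi t.
rewrite pt_iz mxE => dz.
rewrite (_ : (fun s => _) = (fun s => phi s 0 (iz l)) - cst (zcoord p 0 l)).
  by apply: (is_derive_eq (is_deriveB dz (is_derive_cst _ t 1))); rewrite subr0.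
by apply/funext => s; rewrite peval_z_at.
Qed.

Lemma orbit_rad (t : R) : is_derive t 1 (fun s => peval (rad_at p) (phi s))
  (eps * (2 * peval (rad2 R d) (phi t) * peval g (phi t))).
Proof.
rewrite (_ : (fun s => _) = (fun s => phi s 0 (ix d)) ^+ 2
  + (fun s => phi s 0 (iy d)) ^+ 2 - cst (rcoord p ^+ 2)).
  apply: (is_derive_eq (is_deriveB (is_deriveD (is_deriveX 2 (orbit_x t))
    (is_deriveX 2 (orbit_y t))) (is_derive_cst _ t 1))).
  rewrite peval_rad2 /GRing.scale /=; ring.
by apply/funext => s; rewrite peval_rad_at peval_rad2.
Qed.

(** On the circle g vanishes, and what remains is the rotation at unit speed;
    in the rotating frame A, B the solution is constant. *)
Lemma orbit_circle : (forall t, circle_of p (phi t)) ->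
  range phi = circle_of p.
Proof.
move=> cphi.
have [g0 _] := nondegenerate_zero.
have gphi t : peval g (phi t) = 0 by rewrite (radial_circle rg (cphi t)).
pose x t := phi t 0 (ix d); pose y t := phi t 0 (iy d).
have dx (t : R) : is_derive t 1 x (- y t).
  by apply: (is_derive_eq (orbit_x t)); rewrite gphi !mulr0 addr0.
have dy (t : R) : is_derive t 1 y (x t).
  by apply: (is_derive_eq (orbit_y t)); rewrite gphi !mulr0 addr0.
pose A := x * @cos R + y * @sin R; pose B := y * @cos R - x * @sin R.
have dA (t : R) : is_derive t 1 A 0.
  apply: (is_derive_eq (is_deriveD (is_deriveM (dx t) (is_derive_cos t))
    (is_deriveM (dy t) (is_derive_sin t)))).
  rewrite /GRing.scale /=; ring.
have dB (t : R) : is_derive t 1 B 0.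
  apply: (is_derive_eq (is_deriveB (is_deriveM (dy t) (is_derive_cos t))
    (is_deriveM (dx t) (is_derive_sin t)))).
  rewrite /GRing.scale /=; ring.
have xyE t : x t = x 0 * cos t - y 0 * sin t /\ y t = y 0 * cos t + x 0 * sin t.
  have : A t = A 0 by exact: is_derive_0_is_cst.
  have : B t = B 0 by exact: is_derive_0_is_cst.
  rewrite /A /B /= !fctE cos0 sin0 !mulr1 !mulr0 addr0 subr0 => <- <-.
  split; rewrite -[LHS]mulr1 -(cos2Dsin2 t); ring.
apply/seteqP; split=> [_ [t _ <-]//|u [cu zu]].
have [alpha [ua ub]] := polar p_gt0 cu.
have [beta [xb yb]] := polar p_gt0 (proj1 (cphi 0)).
exists (alpha - beta) => //; apply: row_ext.
- rewrite -/(x _) (proj1 (xyE _)) /x /y xb yb ua -{3}(subrK beta alpha).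
  rewrite (cosD (alpha - beta) beta).
  ring.
- rewrite -/(y _) (proj2 (xyE _)) /x /y xb yb ub -{3}(subrK beta alpha).
  rewrite (sinD (alpha - beta) beta).
  ring.
- by move=> l; rewrite zu (proj2 (cphi _)).
Qed.

End Orbit.

Lemma circle_periodic_orbit eps :
  periodic_orbit (vfield (radial_sys g c) eps) (circle_of p).
Proof.
have [g0 c0] := nondegenerate_zero.
pose phi t := cyl t (rcoord p) (zcoord p).
have cphi t : circle_of p (phi t) by exact: circle_cyl.
have dphi (t : R) : is_derive t 1 phi (vfield (radial_sys g c) eps (phi t)).
  apply/is_derive_rowP; apply: coordP => [||l].
  - rewrite pt_ix pevalM (radial_circle rg (cphi t)) g0 !mulr0 addr0.
    rewrite (_ : (fun s => _) = rcoord p *: @cos R).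
      apply: (is_derive_eq (is_deriveZ (rcoord p) (is_derive_cos t))).
      by rewrite pt_iy -mulrN.
    by apply/funext => s; rewrite pt_ix.
  - rewrite pt_iy pevalM (radial_circle rg (cphi t)) g0 !mulr0 addr0.
    rewrite (_ : (fun s => _) = rcoord p *: @sin R).
      apply: (is_derive_eq (is_deriveZ (rcoord p) (is_derive_sin t))).
      by rewrite pt_ix.
    by apply/funext => s; rewrite pt_iy.
  - rewrite pt_iz mxE (radial_circle (rc l) (cphi t)) c0 mulr0.
    rewrite (_ : (fun s => _) = cst (zcoord p 0 l)); first exact: is_derive_cst.
    by apply/funext => s; rewrite pt_iz.
exists phi, (2 * pi); split=> //.
- by rewrite mulr_gt0 // pi_gt0.
- move=> t; apply: row_ext => [||l]; rewrite ?pt_ix ?pt_iy.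
  + by rewrite mulr_natl cosD2pi.
  + by rewrite mulr_natl sinD2pi.
  + by rewrite !pt_iz.
- exists pi => /rowP/(_ (ix d)); rewrite !pt_ix cospi cos0 mulrN1 mulr1.
  by move=> h; have := p_gt0; lra.
- by rewrite (orbit_circle dphi).
Qed.

(** If g = K u then u obeys a scalar linear equation and vanishes, after which
    v does. If g = K v the two equations are coupled and the quadratic function
    of [periodic_planar_eq0] is needed. In both cases the conditions on the
    coefficients are strict polynomial inequalities W > 0 that hold on the
    circle, and so on a neighbourhood of it. *)
Lemma planar_isolated : exists W : bool -> mpoly d.+2 R,
  (forall u, circle_of p u -> forall b, 0 < peval (W b) u) /\
  forall eps T phi, eps != 0 -> 0 < T ->
    (forall t : R, is_derive t 1 phi (vfield (radial_sys g c) eps (phi t))) ->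
    periodic phi T -> (forall t b, 0 < peval (W b) (phi t)) ->
    forall t, peval (rad_at p) (phi t) = 0 /\ peval (z_at p l0) (phi t) = 0.
Proof.
case: ndp => _ [K [N [M [[rK rN rM] K0 M0 cl0 hg]]]].
pose k0 := peval K (base p); pose n0 := peval N (base p).
pose m0 := peval M (base p).
have rad_gt0 : 0 < peval (rad2 R d) (base p) by rewrite rad2_base exprn_gt0.
have [L LE rL] : exists2 L, L = cstp d.+2 2 * rad2 R d * K & radial L.
  exists (cstp d.+2 2 * rad2 R d * K) => //.
  by apply: radialM => //; apply: radialM; [exact: radial_cst|].
case: hg => [gE|[gE N0]].
- exists (fun b => if b then cstp d.+2 k0 * L else cstp d.+2 m0 * M).
  split=> [u cu [|]|eps T phi eps0 T0 dphi phiT Wphi t].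
  + rewrite LE !pevalM !peval_cst (radial_circle (@radial_rad2 R d) cu).
    rewrite (radial_circle rK cu) -/k0.
    have -> : k0 * (2 * peval (rad2 R d) (base p) * k0) =
      2 * peval (rad2 R d) (base p) * k0 ^+ 2 by ring.
    by rewrite pmulr_rgt0 ?exprn_even_gt0 // pmulr_rgt0.
  + by rewrite !pevalM !peval_cst (radial_circle rM cu) -expr2 exprn_even_gt0.
  have rad0 s : peval (rad_at p) (phi s) = 0.
    apply: (@periodic_linear_eq0 _ T T0 (eps * k0)
      (fun s => eps * peval L (phi s)) (fun s => peval (rad_at p) (phi s))).
    - move=> a; have := Wphi a true; rewrite pevalM peval_cst => W0.
      by rewrite mulrACA mulr_gt0 // -expr2 exprn_even_gt0.
    - move=> a; apply: (is_derive_eq (orbit_rad dphi a)).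
      by rewrite gE LE !pevalM peval_cst; ring.
    - by move=> a; rewrite phiT.
  split; first exact: rad0.
  apply: (@periodic_linear_eq0 _ T T0 (eps * m0)
    (fun s => eps * peval M (phi s)) (fun s => peval (z_at p l0) (phi s))).
  + move=> a; have := Wphi a false; rewrite pevalM peval_cst => W0.
    by rewrite mulrACA mulr_gt0 // -expr2 exprn_even_gt0.
  + move=> a; apply: (is_derive_eq (orbit_z dphi a l0)).
    by rewrite cl0 pevalD !pevalM rad0 mulr0 add0r mulrA.
  + by move=> a; rewrite phiT.
- pose kL := peval L (base p).
  have kL0 : kL != 0.
    by rewrite /kL LE !pevalM peval_cst !mulf_neq0 ?pnatr_eq0 // gt_eqF.
  (* The equation for u is u' = eps L v: here L and kL are K and k0. *)
  pose e := (n0^-1 - kL) / (2 * m0).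
  pose a := - (m0 + 2 * e * n0) / (2 * kL).
  pose D := cstp d.+2 4 * N * (L + cstp d.+2 (2 * e) * M)
    - (cstp d.+2 (2 * a) * L + M + cstp d.+2 (2 * e) * N) ^+ 2.
  exists (fun b => if b then cstp d.+2 n0 * N else D).
  split=> [u cu [|]|eps T phi eps0 T0 dphi phiT Wphi t].
  + by rewrite !pevalM !peval_cst (radial_circle rN cu) -expr2 exprn_even_gt0.
  + rewrite /D !pevalE (radial_circle rN cu) (radial_circle rM cu).
    rewrite (radial_circle rL cu) -/kL -/n0 -/m0.
    have -> : 2 * a * kL + m0 + 2 * e * n0 = 0.
      by rewrite /a; field; rewrite kL0.
    have -> : kL + 2 * e * m0 = n0^-1.
      by rewrite /e; field; rewrite M0 N0.
    by rewrite expr0n subr0 mulfK.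
  apply: (@periodic_planar_eq0 _ T T0 eps kL n0 m0
    (fun s => peval L (phi s)) (fun s => peval N (phi s))
    (fun s => peval M (phi s)) (fun s => peval (rad_at p) (phi s))
    (fun s => peval (z_at p l0) (phi s))) => //.
  + by move=> s; have := Wphi s true; rewrite pevalM peval_cst.
  + by move=> s; have := Wphi s false; rewrite /D !pevalE.
  + move=> s; apply: (is_derive_eq (orbit_rad dphi s)).
    by rewrite gE LE !pevalM peval_cst; ring.
  + move=> s; apply: (is_derive_eq (orbit_z dphi s l0)).
    by rewrite cl0 pevalD !pevalM.
  + by move=> s; rewrite phiT.
  + by move=> s; rewrite phiT.
Qed.

(** A periodic orbit that stays where the inequalities of [planar_isolated] hold
    and the coefficients Q_l keep their sign has the s and z of p, so it is the
    circle itself. *)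
Lemma nondegenerate_limit_cycle eps : eps != 0 ->
  limit_cycle (vfield (radial_sys g c) eps) (circle_of p).
Proof.
move=> eps0; split; first exact: circle_periodic_orbit.
have [W [W0 Wrigid]] := planar_isolated.
case: ndp => -[Q hQ] _.
pose V (i : bool + 'I_d) := match i with
  | inl b => W b
  | inr l => if l == l0 then cstp d.+2 1 else
               cstp d.+2 (peval (Q l) (base p)) * Q l
  end.
exists [set u | forall i, 0 < peval (V i) u]; split.
- exact: open_peval_gt0.
- move=> u cu [b|l] /=; first exact: W0.
  have [_|/hQ[rQ Q0 _]] := eqVneq l l0; first by rewrite peval_cst.
  by rewrite pevalM peval_cst (radial_circle rQ cu) -expr2 exprn_even_gt0.
- move=> G' [phi [T [T0 dphi phiT _ ->]]] phiV.
  have Vphi t i : 0 < peval (V i) (phi t) by apply: phiV; exists t.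
  have zrad t : peval (rad_at p) (phi t) = 0 /\ peval (z_at p l0) (phi t) = 0.
    by apply: (Wrigid eps T) => // s b; exact: (Vphi s (inl b)).
  apply: (orbit_circle dphi) => t; apply/circle_ofP; split=> [|l].
    by apply/eqP; rewrite rad2_base -subr_eq0 -peval_rad_at (proj1 (zrad t)).
  rewrite pt_iz; apply/eqP; rewrite -subr_eq0 -peval_z_at; apply/eqP.
  have [->|ll0] := eqVneq l l0; first exact: (proj2 (zrad t)).
  have [rQ Q0 cl] := hQ l ll0.
  apply: (@periodic_linear_eq0 _ T T0 (eps * peval (Q l) (base p))
    (fun s => eps * peval (Q l) (phi s)) (fun s => peval (z_at p l) (phi s))).
  + move=> s; have := Vphi s (inr l).
    rewrite /V (negPf ll0) pevalM peval_cst => QQ.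
    by rewrite mulrACA mulr_gt0 // -expr2 exprn_even_gt0.
  + move=> s; apply: (is_derive_eq (orbit_z dphi s l)).
    by rewrite cl !pevalM mulrA.
  + by move=> s; rewrite phiT.
Qed.

End Nondegenerate.

(** * A planar system with the maximal number of zeros *)

Section PlanarZeros.
Variables (R : realType) (d : nat) (l0 : 'I_d).
Variables (b : bool) (ss rhos : seq R) (k : R).
Hypotheses (ss_uniq : uniq ss) (rhos_uniq : uniq rhos).
Hypothesis ss_lt : forall s rho, s \in ss -> rho \in rhos -> s < rho.
Hypotheses (k_neq0 : k != 0).
Hypothesis k_free : forall s rho, s \in ss -> rho \in rhos -> s != rho - k ^+ 2.

Let Z : mpoly d.+2 R := var R (iz l0).
Let Rad : mpoly d.+2 R := rad2 R d.

(** With weight 2 for s = x^2 + y^2 and weight 1 for z, g has weight n - 1 and h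
    has weight n, for n = b + 2 (size rhos). On each line s = s_i the polynomial
    h has n roots z; when n is even the line z = k adds the n / 2 points
    s = rho - k^2, and the total is n (n - 1) / 2 for either parity. The value
    k = 0 has to be avoided: h would then be even in z, the planar system
    reversible, and an equilibrium on that line could be a center. *)
Definition planar_g : mpoly d.+2 R :=
  (if b then 1 else Z - cstp d.+2 k) * \prod_(s <- ss) (Rad - cstp d.+2 s).

Definition planar_h : mpoly d.+2 R :=
  (if b then Z else 1) * \prod_(rho <- rhos) (Z ^+ 2 + Rad - cstp d.+2 rho).

Definition heights (s : R) : seq R :=
  (if b then [:: 0] else [::]) ++
  [seq Num.sqrt (rho - s) | rho <- rhos] ++
  [seq - Num.sqrt (rho - s) | rho <- rhos].

Definition planar_zeros : seq (R * R) :=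
  [seq (s, z) | s <- ss, z <- heights s] ++
  (if b then [::] else [seq (rho - k ^+ 2, k) | rho <- rhos]).

Lemma radial_planar_g : radial planar_g.
Proof.
apply: radialM; last first.
  by apply: radial_prod => s; apply: radialB => //; apply: radial_cst.
case: b; first exact: (@radial_cst R d 1).
by apply: radialB; [exact: radial_z|exact: radial_cst].
Qed.

Lemma radial_quadric rho : radial (Z ^+ 2 + Rad - cstp d.+2 rho).
Proof.
apply: radialB; last exact: radial_cst.
by apply: radialD => //; apply: radialX; exact: radial_z.
Qed.

Lemma peval_quadric rho u : peval (Z ^+ 2 + Rad - cstp d.+2 rho) u =
  u 0 (iz l0) ^+ 2 + peval Rad u - rho.
Proof. by rewrite pevalB pevalD pevalXn peval_var peval_cst. Qed.

Lemma radial_odd_factor : radial (if b then Z else 1).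
Proof. by case: b; [exact: radial_z|exact: (@radial_cst R d 1)]. Qed.

Lemma radial_planar_h : radial planar_h.
Proof.
apply: radialM; first exact: radial_odd_factor.
by apply: radial_prod; exact: radial_quadric.
Qed.

Lemma deg_le_planar_g : deg_le (~~ b + 2 * size ss) planar_g.
Proof.
apply: deg_leM.
  case: b; first exact: (@deg_le_cst R d.+2 _ 1).
  by apply: deg_leB; [exact: deg_le_var|exact: deg_le_cst].
rewrite mulnC; apply: deg_le_prod => s; apply: deg_leB; last exact: deg_le_cst.
by apply: deg_leD; apply: (@deg_le_sqr _ _ 1); exact: deg_le_var.
Qed.

Lemma deg_le_planar_h : deg_le (b + 2 * size rhos) planar_h.
Proof.
apply: deg_leM.
  by case: b; [exact: deg_le_var|exact: (@deg_le_cst R d.+2 _ 1)].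
rewrite mulnC; apply: deg_le_prod => rho; apply: deg_leB; last exact: deg_le_cst.
by apply: deg_leD; [|apply: deg_leD]; apply: (@deg_le_sqr _ _ 1);
   exact: deg_le_var.
Qed.

Lemma sqrt_gap s rho : s \in ss -> rho \in rhos ->
  0 < Num.sqrt (rho - s) /\ Num.sqrt (rho - s) ^+ 2 = rho - s.
Proof.
move=> sS rR; have lt0 : 0 < rho - s by rewrite subr_gt0 ss_lt.
by rewrite sqrtr_gt0 sqr_sqrtr // ltW.
Qed.

Lemma uniq_heights s : s \in ss -> uniq (heights s).
Proof.
move=> sS.
have inj : {in rhos &, injective (fun rho => Num.sqrt (rho - s))}.
  move=> x y xR yR /= exy; have [_ ex] := sqrt_gap sS xR.
  have [_ ey] := sqrt_gap sS yR.
  by apply: (addIr (- s)); rewrite -ex -ey exy.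
rewrite !cat_uniq !map_inj_in_uniq ?rhos_uniq //=; last first.
  by move=> x y xR yR /oppr_inj; exact: inj.
rewrite andbT; apply/and3P; split; first by case: b.
- apply/hasPn => x; rewrite mem_cat => xin; case: b => //=.
  rewrite inE; apply/eqP => x0; move: xin.
  rewrite {}x0 => /orP[] /mapP[rho rR] /esym/eqP;
    have [gt0 _] := sqrt_gap sS rR; by rewrite ?oppr_eq0 gt_eqF.
- apply/hasPn => x /mapP[rho rR ->]; apply/negP => /mapP[rho' rR'] e.
  have [gt0 _] := sqrt_gap sS rR; have [gt0' _] := sqrt_gap sS rR'.
  by move: gt0' gt0; rewrite -e oppr_gt0 => /lt_trans h /h; rewrite ltxx.
Qed.

Lemma mem_heights s z : s \in ss -> z \in heights s ->
  b /\ z = 0 \/ z != 0 /\ exists2 rho, rho \in rhos & z ^+ 2 = rho - s.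
Proof.
move=> sS; rewrite !mem_cat => /or3P[|/mapP[rho rR ->]|/mapP[rho rR ->]].
- by case: b => //; rewrite inE => /eqP ->; left.
- have [gt0 e] := sqrt_gap sS rR; right; rewrite gt_eqF //.
  by split=> //; exists rho.
- have [gt0 e] := sqrt_gap sS rR; right; rewrite oppr_eq0 gt_eqF // sqrrN.
  by split=> //; exists rho.
Qed.

Lemma planar_zeros_case s z : (s, z) \in planar_zeros ->
  (s \in ss /\ z \in heights s) \/
  [/\ ~~ b, z = k & exists2 rho, rho \in rhos & s = rho - k ^+ 2].
Proof.
rewrite mem_cat => /orP[/allpairsPdep[s' [z' [sS zH [-> ->]]]]|]; first by left.
case: b => // /mapP[rho rR [-> ->]]; right; split=> //.
by exists rho.
Qed.

Lemma uniq_planar_zeros : uniq planar_zeros.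
Proof.
rewrite cat_uniq; apply/and3P; split.
- apply: allpairs_uniq_dep => //; first exact: uniq_heights.
  by move=> [x y] [x' y'] _ _ [-> ->].
- apply/hasPn; case: b => // _ /mapP[rho rR ->].
  apply/negP => /allpairsPdep[s [z [sS _ [/esym/eqP]]]].
  by rewrite (negPf (k_free sS rR)).
- case: b => //; rewrite map_inj_uniq // => x y [] /addIr; exact.
Qed.

Lemma size_planar_zeros : size planar_zeros =
  (size ss * (b + 2 * size rhos) + ~~ b * size rhos)%N.
Proof.
rewrite size_cat; congr (_ + _)%N; last by case: b; rewrite ?size_map ?mul1n.
have szH s : size (heights s) = (b + 2 * size rhos)%N.
  by rewrite !size_cat !size_map mul2n addnn; case: b.
rewrite size_allpairs_dep (eq_map szH).
by elim: (ss) => //= _ r ->.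
Qed.

Lemma zero_in_planar_zeros u : peval planar_g u = 0 -> peval planar_h u = 0 ->
  (peval Rad u, u 0 (iz l0)) \in planar_zeros.
Proof.
have quadric : peval planar_h u = 0 ->
    (exists2 rho, rho \in rhos & u 0 (iz l0) ^+ 2 = rho - peval Rad u)
    \/ b /\ u 0 (iz l0) = 0.
  rewrite pevalM peval_prod => /eqP.
  rewrite mulf_eq0 prodf_seq_eq0 => /orP[|/hasP[rho rR]].
    case: b; first by rewrite peval_var => /eqP; right.
    by rewrite peval1 oner_eq0.
  rewrite /= peval_quadric => /eqP e; left; exists rho => //.
  by apply/eqP; rewrite -subr_eq0 -e; apply/eqP; ring.
move=> + /quadric h0; rewrite pevalM peval_prod => /eqP.
rewrite mulf_eq0 prodf_seq_eq0 mem_cat => /orP[|/hasP[s sS]].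
  case: b h0 => [|[[rho rR e]|[//]]]; first by rewrite peval1 oner_eq0.
  rewrite pevalB peval_var peval_cst subr_eq0 => /eqP uk; apply/orP; right.
  by apply/mapP; exists rho => //; rewrite -uk e subKr.
rewrite /= pevalB peval_cst subr_eq0 => /eqP us; apply/orP; left.
rewrite us in h0 *; apply/allpairsPdep; exists s, (u 0 (iz l0)); split=> //.
rewrite !mem_cat; case: h0 => [[rho rR e]|[-> ->]]; last by rewrite inE eqxx.
have [gt0 e'] := sqrt_gap sS rR.
move/eqP: e; rewrite -e' eqf_sqr => /orP[] /eqP ->; apply/or3P.
  by apply: Or32; apply/mapP; exists rho.
by apply: Or33; apply/mapP; exists rho.
Qed.

Lemma prod_rem_neq0 (r : seq R) (F : R -> mpoly d.+2 R) x u : uniq r ->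
  (forall y, y \in r -> y != x -> peval (F y) u != 0) ->
  peval (\prod_(y <- rem x r) F y) u != 0.
Proof.
move=> r_uniq F0; rewrite peval_prod prodf_seq_neq0; apply/allP => y.
by rewrite mem_rem_uniq // inE => /andP[yx yr]; exact: F0.
Qed.

(** With rho = s_p + z_p^2 one has
    z^2 + s - rho = (s - s_p) + (z + z_p) (z - z_p), so that M is 2 z_p times N
    on the orbit. *)
Lemma planar_h_factor (p : 'rV[R]_d.+1) rho : rho \in rhos ->
  zcoord p 0 l0 != 0 -> zcoord p 0 l0 ^+ 2 = rho - rcoord p ^+ 2 ->
  exists N M, [/\ radial N, radial M, peval N (base p) != 0,
    peval M (base p) != 0 & planar_h = N * rad_at p + M * z_at p l0].
Proof.
move=> rR z0 zrho; set z := zcoord p 0 l0 in z0 zrho *.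
pose N := (if b then Z else 1) *
  \prod_(y <- rem rho rhos) (Z ^+ 2 + Rad - cstp d.+2 y).
have rN : radial N.
  apply: radialM; first exact: radial_odd_factor.
  by apply: radial_prod; exact: radial_quadric.
have zb : base p 0 (iz l0) = z by rewrite pt_iz.
have N0 : peval N (base p) != 0.
  rewrite pevalM mulf_neq0 //.
    by case: b; rewrite ?peval_var ?zb // peval1 oner_eq0.
  apply: prod_rem_neq0 => // y yR yrho.
  by rewrite peval_quadric zb rad2_base zrho subrK subr_eq0 eq_sym.
exists N, (N * (Z + cstp d.+2 z)); split=> //.
- apply: radialM => //.
  by apply: radialD; [exact: radial_z|exact: radial_cst].
- by rewrite pevalM mulf_neq0 // !pevalE zb -mulr2n mulrn_eq0.
rewrite /planar_h (big_rem _ rR) /=.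
have -> : cstp d.+2 rho = cstp d.+2 (rcoord p ^+ 2) + cstp d.+2 z ^+ 2.
  by rewrite /cstp [mpolyC _ z ^+ 2]expr2 -mpolyCM -mpolyCD -expr2 zrho addrC subrK.
rewrite /N /rad_at /z_at -/z -/Z -/Rad; ring.
Qed.

(** Removing the factor that vanishes from each product leaves the coefficients
    K and N; they are nonzero at the zero because the roots are simple. *)
Lemma planar_zeros_nondegenerate (p : 'rV[R]_d.+1) :
  (rcoord p ^+ 2, zcoord p 0 l0) \in planar_zeros ->
  exists K N M : mpoly d.+2 R,
    [/\ [/\ radial K, radial N & radial M],
        peval K (base p) != 0, peval M (base p) != 0,
        planar_h = N * rad_at p + M * z_at p l0
      & planar_g = K * rad_at p \/
        planar_g = K * z_at p l0 /\ peval N (base p) != 0].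
Proof.
set z := zcoord p 0 l0; have zb : base p 0 (iz l0) = z by rewrite pt_iz.
have rs s : radial (Rad - cstp d.+2 s).
  by apply: radialB => //; exact: radial_cst.
case/planar_zeros_case => [[sS zH]|[nb zk [rho rR srho]]].
  pose K := (if b then 1 else Z - cstp d.+2 k) *
    \prod_(y <- rem (rcoord p ^+ 2) ss) (Rad - cstp d.+2 y).
  have rK : radial K.
    apply: radialM; last exact: radial_prod.
    case: b; first exact: (@radial_cst R d 1).
    by apply: radialB; [exact: radial_z|exact: radial_cst].
  have K0 : peval K (base p) != 0.
    rewrite pevalM mulf_neq0 //.
      have := mem_heights sS zH; case: b => [_|[[//]|[z0 [rho rR e]]]].
        by rewrite peval1 oner_eq0.
      rewrite !pevalE zb subr_eq0; apply: contraNneq (k_free sS rR) => <-.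
      by rewrite e subKr.
    apply: prod_rem_neq0 => // y yS yrho.
    by rewrite pevalB rad2_base peval_cst subr_eq0 eq_sym.
  have gE : planar_g = K * rad_at p.
    by rewrite /planar_g (big_rem _ sS) /= /K -mulrA [X in _ = _ * X]mulrC.
  case: (mem_heights sS zH) => [[bT z0]|[z0 [rho rR e]]]; last first.
    have [N [M [rN rM N0 M0 hE]]] := planar_h_factor rR z0 e.
    by exists K, N, M; split=> //; left.
  pose M := \prod_(rho <- rhos) (Z ^+ 2 + Rad - cstp d.+2 rho).
  (* The remaining height z = 0 is a root of the extra factor Z of h. *)
  exists K, (cstp d.+2 0), M; split=> //; last by left.
  - split=> //; first exact: radial_cst.
    by apply: radial_prod; exact: radial_quadric.
  - rewrite peval_prod prodf_seq_neq0; apply/allP => rho rR.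
    by rewrite /= peval_quadric zb z0 rad2_base expr0n add0r subr_eq0 lt_eqF // ss_lt.
  - rewrite /planar_h bT /z_at -/z z0 /cstp mpolyC0 subr0 mul0r add0r.
    by rewrite mulrC.
have z0 : z != 0 by rewrite zk.
have e : z ^+ 2 = rho - rcoord p ^+ 2 by rewrite zk srho subKr.
have [N [M [rN rM N0 M0 hE]]] := planar_h_factor rR z0 e.
exists (\prod_(s <- ss) (Rad - cstp d.+2 s)), N, M; split=> //.
- by split=> //; exact: radial_prod.
- rewrite peval_prod prodf_seq_neq0; apply/allP => s sS.
  rewrite /= pevalB rad2_base peval_cst subr_eq0 srho eq_sym.
  exact: k_free.
- right; split=> //.
  by rewrite /planar_g (negPf nb) /z_at -/z zk mulrC.
Qed.

End PlanarZeros.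

(** * Small parameters and the count of zeros *)

(** One small tau scales everything: the s_i lie in (0, n tau], the rho start at
    (n + 1) tau, and k = tau has k^2 < tau, which is less than the gap
    between the two families. *)
Lemma small_parameters (R : realType) (n : nat) (B : R) : 0 < B ->
  exists (ss rhos zetas : seq R) (k : R),
  [/\ [/\ size ss = n.-1./2, size rhos = n./2 & size zetas = n],
      [/\ uniq ss, uniq rhos & uniq zetas],
      k != 0 /\ k ^+ 2 < B,
      (forall s, s \in ss -> 0 < s < B) /\
      (forall rho, rho \in rhos -> k ^+ 2 < rho < B)
    & (forall s rho, s \in ss -> rho \in rhos -> s < rho - k ^+ 2) /\
      (forall zeta, zeta \in zetas -> zeta ^+ 2 < B)].
Proof.
move=> B0; have c0 : 0 < (2 * n.+1)%:R :> R by rewrite ltr0n.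
pose tau := Num.min (2^-1) (B / (2 * n.+1)%:R).
have tau0 : 0 < tau by rewrite lt_min invr_gt0 ltr0n divr_gt0.
have tau1 : tau < 1.
  by apply: (@le_lt_trans _ _ (2^-1)); [rewrite ge_min lexx|lra].
have tauB m : (m <= 2 * n.+1)%N -> tau * m%:R <= B.
  move=> mn; apply: (@le_trans _ _ (tau * (2 * n.+1)%:R)).
    by rewrite ler_pM2l // ler_nat.
  by rewrite -ler_pdivlMr // ge_min lexx orbT.
have tauS m : (m < 2 * n.+1)%N -> tau * m%:R < B.
  by move=> mn; apply: lt_le_trans (tauB _ mn); rewrite ltr_pM2l // ltr_nat.
have tau2 : tau ^+ 2 < tau by rewrite expr2 gtr_pMr.
have tauB1 : tau < B by rewrite -[tau]mulr1; apply: (tauS 1%N); lia.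
have tau_inj : injective (fun m : nat => tau * m%:R).
  by move=> x y /(mulfI (lt0r_neq0 tau0)) /eqP; rewrite eqr_nat => /eqP.
exists [seq tau * i.+1%:R | i <- iota 0 n.-1./2].
exists [seq tau * (n.+1 + i)%:R | i <- iota 0 n./2].
exists [seq tau / i.+1%:R | i <- iota 0 n]; exists tau; split.
- by rewrite !size_map !size_iota.
- split; rewrite map_inj_uniq ?iota_uniq //.
  + by move=> x y /tau_inj [].
  + by move=> x y /tau_inj /addnI.
  + move=> x y /(mulfI (lt0r_neq0 tau0)) /invr_inj /eqP.
    by rewrite eqr_nat eqSS => /eqP.
- by rewrite gt_eqF //; split=> //; apply: lt_trans tauB1.
- split=> x /mapP[i]; rewrite mem_iota => /andP[_ ilt] ->.
    by rewrite mulr_gt0 ?ltr0n //= tauS //; lia.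
  rewrite tauS ?andbT; last lia.
  by apply: (lt_le_trans tau2); rewrite ler_peMr ?(ltW tau0) // ler1n.
- split=> [s rho /mapP[i + ->] /mapP[j + ->]|zeta /mapP[i _ ->]].
    rewrite !mem_iota => ilt jlt.
    have : tau * i.+1%:R + tau <= tau * (n.+1 + j)%:R.
      by rewrite -[X in _ + X <= _]mulr1 -mulrDr natr1 ler_pM2l // ler_nat; lia.
    by move: tau2; lra.
  rewrite expr_div_n; apply: (@le_lt_trans _ _ (tau ^+ 2)).
    by rewrite ler_pdivrMr ?exprn_gt0 // ler_peMr ?sqr_ge0 // exprn_ege1 ?ler1n.
  exact: lt_trans tauB1.
Qed.

Lemma odd_half_pred (n : nat) : (0 < n)%N ->
  (1 + ~~ odd n + 2 * n.-1./2 = n)%N.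
Proof.
case: n => // m _ /=; rewrite negbK mul2n -addnA odd_double_half.
exact: add1n.
Qed.

(** Twice the number of planar zeros is n (n - 1), which makes the division by 2
    exact. *)
Lemma ncyclesE (d n : nat) : (1 <= n)%N ->
  ncycles d.+1 n =
  ((n.-1./2 * (odd n + 2 * n./2) + ~~ odd n * n./2) * n ^ d)%N.
Proof.
move=> n0; have nE : (odd n + 2 * n./2 = n)%N by rewrite mul2n odd_double_half.
have e2 : (n * n.-1 = 2 * (n.-1./2 * (odd n + 2 * n./2) + ~~ odd n * n./2))%N.
  rewrite nE; case: n n0 {nE} => // m _ /=; rewrite uphalf_half negbK.
  have := odd_double_half m; case: (odd m); move: m./2 => h <- /=;
    rewrite -mul2n; ring.
by rewrite /ncycles expnSr -mulnA e2 mulnCA mulKn // mulnC.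
Qed.

Lemma circle_in_ball (R : realType) (d : nat) (delta B : R)
    (p : 'rV[R]_d.+1) (u : 'rV[R]_d.+2) :
  B * d.+1%:R = delta ^+ 2 -> rcoord p ^+ 2 < B ->
  (forall l, zcoord p 0 l ^+ 2 <= B) -> circle_of p u -> euclid_ball0 delta u.
Proof.
move=> BE rB zB [cu zu]; rewrite /euclid_ball0 /= -BE !big_ord_recl addrA cu.
rewrite -natr1 mulrDr mulr1 addrC ler_ltD //.
rewrite mulr_natr -[leRHS]/(B *+ d) -[X in _ *+ X](card_ord d) -sumr_const.
by apply: ler_sum => l _; rewrite zu.
Qed.

(** * The system *)

Section System.
Variables (R : realType) (d n : nat) (ss rhos zetas : seq R) (k B : R).
Hypotheses (n_gt0 : (0 < n)%N) (size_ss : size ss = n.-1./2)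
  (size_rhos : size rhos = n./2) (size_zetas : size zetas = n).
Hypotheses (ss_uniq : uniq ss) (rhos_uniq : uniq rhos)
  (zetas_uniq : uniq zetas).
Hypotheses (k_neq0 : k != 0) (kB : k ^+ 2 < B).
Hypothesis ssB : forall s, s \in ss -> 0 < s < B.
Hypothesis rhosB : forall rho, rho \in rhos -> k ^+ 2 < rho < B.
Hypothesis gap : forall s rho, s \in ss -> rho \in rhos -> s < rho - k ^+ 2.
Hypothesis zetasB : forall zeta, zeta \in zetas -> zeta ^+ 2 < B.

Let l0 : 'I_d.+1 := ord0.

Definition sys_g : mpoly d.+3 R := planar_g l0 (odd n) ss k.

Definition scalar_q (l : 'I_d.+1) : mpoly d.+3 R :=
  \prod_(zeta <- zetas) (var R (iz l) - cstp d.+3 zeta).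

(** The first coordinate z_0 is coupled to the radius; each other coordinate has
    its own scalar equation with n simple roots. *)
Definition sys_c (l : 'I_d.+1) : mpoly d.+3 R :=
  if l == l0 then planar_h l0 (odd n) rhos else scalar_q l.

Definition zeros2 : seq (R * R) := planar_zeros (odd n) ss rhos k.

Lemma ss_lt_rhos s rho : s \in ss -> rho \in rhos -> s < rho.
Proof.
by move=> sS rR; apply: lt_le_trans (gap sS rR) _; rewrite gerBl sqr_ge0.
Qed.

Lemma ss_neq_shift s rho : s \in ss -> rho \in rhos -> s != rho - k ^+ 2.
Proof. by move=> sS rR; rewrite lt_eqF // gap. Qed.

Lemma radial_scalar_q l : radial (scalar_q l).
Proof.
apply: radial_prod => zeta; apply: radialB; first exact: radial_z.
exact: radial_cst.
Qed.

Lemma radial_sys_g : radial sys_g. Proof. exact: radial_planar_g. Qed.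

Lemma radial_sys_c l : radial (sys_c l).
Proof.
rewrite /sys_c; case: eqP => _; first exact: radial_planar_h.
exact: radial_scalar_q.
Qed.

Lemma deg_le_sys_g (i : 'I_d.+3) : deg_le n (var R i * sys_g).
Proof.
apply: deg_leS (deg_leM (deg_le_var _ _) (deg_le_planar_g _ _ _ _)).
by rewrite size_ss addnA odd_half_pred.
Qed.

Lemma deg_le_sys_c l : deg_le n (sys_c l).
Proof.
rewrite /sys_c; case: eqP => _.
  apply: deg_leS (deg_le_planar_h _ _ _).
  by rewrite size_rhos mul2n odd_double_half.
rewrite -[n]muln1 -size_zetas; apply: deg_le_prod => zeta.
by apply: deg_leB; [exact: deg_le_var|exact: deg_le_cst].
Qed.

Lemma zeros2B s z : (s, z) \in zeros2 -> 0 < s < B /\ z ^+ 2 <= B.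
Proof.
case/planar_zeros_case => [[sS zH]|[_ -> [rho rR ->]]].
  split; first exact: ssB.
  case: (mem_heights ss_lt_rhos sS zH) => [[_ ->]|[_ [rho rR ->]]].
    by rewrite expr0n /=; apply: le_trans (ltW kB); exact: sqr_ge0.
  have /andP[s0 _] := ssB sS; have /andP[_ rB] := rhosB rR.
  by move: s0 rB; lra.
have /andP[kr rB] := rhosB rR; have k2 := sqr_ge0 k.
by split; [apply/andP; split|]; lra.
Qed.

Definition zero_cond (p : 'rV[R]_d.+2) :=
  (rcoord p ^+ 2, zcoord p 0 l0) \in zeros2 /\
  forall l, l != l0 -> zcoord p 0 l \in zetas.

Lemma zero_cond_nondegenerate p :
  zero_cond p -> nondegenerate l0 sys_g sys_c p.
Proof.
case=> z2 zz; split; last first.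
  have := planar_zeros_nondegenerate ss_uniq rhos_uniq ss_lt_rhos k_neq0
    ss_neq_shift z2.
  by rewrite /sys_c eqxx.
exists (fun l => \prod_(zeta <- rem (zcoord p 0 l) zetas)
  (var R (iz l) - cstp d.+3 zeta)) => l ll0; split.
- apply: radial_prod => zeta; apply: radialB; first exact: radial_z.
  exact: radial_cst.
- apply: prod_rem_neq0 => // zeta _ zl.
  by rewrite pevalB peval_var peval_cst pt_iz subr_eq0 eq_sym.
- by rewrite /sys_c (negPf ll0) /scalar_q (big_rem _ (zz l ll0)) /= mulrC.
Qed.

Lemma zero_condP p : 0 < rcoord p ->
  simple_zero (averaged (radial_sys sys_g sys_c)) p <-> zero_cond p.
Proof.
move=> p0; split=> [[fp _]|zp]; last first.
  apply: nondegenerate_simple p0 (zero_cond_nondegenerate zp).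
    exact: radial_sys_g.
  exact: radial_sys_c.
have /(averaged_eq0 radial_sys_g radial_sys_c p0)[g0 c0] := fp.
split=> [|l ll0].
  have h0 : peval (planar_h l0 (odd n) rhos) (base p) = 0.
    by have := c0 l0; rewrite /sys_c eqxx.
  have := zero_in_planar_zeros ss_lt_rhos g0 h0.
  by rewrite rad2_base pt_iz.
have := c0 l; rewrite /sys_c (negPf ll0) peval_prod => /eqP.
rewrite prodf_seq_eq0 => /hasP[zeta zz] /=.
by rewrite pevalB peval_var peval_cst pt_iz subr_eq0 => /eqP ->.
Qed.

Definition zero_index : finType :=
  ('I_(size zeros2) * {ffun 'I_d -> 'I_n})%type.

(** The defaults of nth are never reached once zetas has size n. *)
Definition zero_of (t : zero_index) : 'rV[R]_d.+2 :=
  let: (s, z) := nth (0, 0) zeros2 t.1 in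
  \row_i if unlift ord0 i is Some l then
           if unlift l0 l is Some j then nth 0 zetas (t.2 j) else z
         else Num.sqrt s.

Lemma zero_of_planar t :
  (rcoord (zero_of t) ^+ 2, zcoord (zero_of t) 0 l0) = nth (0, 0) zeros2 t.1.
Proof.
have := mem_nth (0, 0) (ltn_ord t.1).
rewrite /zero_of /rcoord /zcoord; case: (nth _ _ _) => s z /zeros2B[/andP[s0 _] _].
by rewrite !mxE unlift_none liftK unlift_none sqr_sqrtr // ltW.
Qed.

Lemma zero_of_scalar t j :
  zcoord (zero_of t) 0 (lift l0 j) = nth 0 zetas (t.2 j).
Proof.
by rewrite /zero_of /zcoord; case: (nth _ _ _) => s z; rewrite !mxE !liftK.
Qed.

Lemma zero_of_gt0 t : 0 < rcoord (zero_of t).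
Proof.
have := mem_nth (0, 0) (ltn_ord t.1).
rewrite /zero_of /rcoord; case: (nth _ _ _) => s z /zeros2B[/andP[s0 _] _].
by rewrite mxE unlift_none sqrtr_gt0.
Qed.

Lemma zero_of_cond t : zero_cond (zero_of t).
Proof.
split=> [|l]; first by rewrite zero_of_planar mem_nth.
have [j ->|->] := unliftP l0 l; last by rewrite eqxx.
by rewrite zero_of_scalar mem_nth // size_zetas.
Qed.

Lemma zero_of_inj : injective zero_of.
Proof.
move=> [i f] [i' f'] e; have := zero_of_planar (i, f).
rewrite e zero_of_planar /= => /eqP.
rewrite nth_uniq //; last first.
  exact: uniq_planar_zeros ss_uniq rhos_uniq ss_lt_rhos ss_neq_shift.
move=> /eqP/val_inj ->; congr (_, _); apply/ffunP => j.
have := zero_of_scalar (i, f) j; rewrite e zero_of_scalar /= => /eqP.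
by rewrite nth_uniq ?size_zetas // => /eqP/val_inj ->.
Qed.

Lemma zero_of_surj p : 0 < rcoord p -> zero_cond p -> exists t, zero_of t = p.
Proof.
move=> p0 [z2 zz].
have i_lt := z2; rewrite -index_mem in i_lt.
have f_lt (j : 'I_d) : (index (zcoord p 0%R (lift l0 j)) zetas < n)%N.
  by rewrite -[n]size_zetas index_mem zz // eq_sym neq_lift.
pose t : zero_index := (Ordinal i_lt, [ffun j => Ordinal (f_lt j)]).
have [r2 zl0] : rcoord (zero_of t) ^+ 2 = rcoord p ^+ 2 /\
    zcoord (zero_of t) 0 l0 = zcoord p 0 l0.
  by have := zero_of_planar t; rewrite /= nth_index // => -[].
exists t; apply/rowP => i; have [l ->|->] := unliftP ord0 i; last first.
  by apply/eqP; rewrite -(@eqrXn2 _ 2) ?ltW ?zero_of_gt0 //; apply/eqP.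
suff : zcoord (zero_of t) 0 l = zcoord p 0 l by rewrite !mxE.
have [j ->|->//] := unliftP l0 l.
by rewrite zero_of_scalar ffunE /= nth_index // zz // eq_sym neq_lift.
Qed.

Lemma card_zero_index : #|zero_index| = ncycles d.+1 n.
Proof.
rewrite card_prod card_ffun !card_ord ncyclesE // size_planar_zeros.
by rewrite size_ss size_rhos.
Qed.

Lemma zero_ofB t :
  rcoord (zero_of t) ^+ 2 < B /\ forall l, zcoord (zero_of t) 0 l ^+ 2 <= B.
Proof.
have [z2 zz] := zero_of_cond t; have [/andP[_ rB] zB] := zeros2B z2.
split=> // l; have [->//|/zz/zetasB/ltW//] := eqVneq l l0.
Qed.

End System.

Theorem corollary3 (R : realType) (d n : nat) (hd : (1 <= d)%N) (hn : (1 <= n)%N)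
    (delta : R) (hdelta : 0 < delta) :
  exists S : polysys R d,
    [/\ deg_le n (Pa S) /\ deg_le n (Pb S),
        forall l : 'I_d, deg_le n (Pc S l),
        no_pure_z (Pa S) /\ no_pure_z (Pb S)
      & exists zero : 'I_(ncycles d n) -> 'rV[R]_d.+1,
          [/\ injective zero,
              range zero =
                [set p | simple_zero (averaged S) p /\ 0 < rcoord p]
            & exists (G : 'I_(ncycles d n) -> R -> set 'rV[R]_d.+2) (eps0 : R),
                [/\ 0 < eps0,
                    forall eps : R, 0 < `|eps| < eps0 ->
                      [/\ forall i, limit_cycle (vfield S eps) (G i eps),
                          forall i j, i != j -> G i eps <> G j eps
                        & forall i, G i eps `<=` euclid_ball0 delta]
                  & forall i, orbits_cvg0 (G i) (circle_of (zero i))]]].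
Proof.
case: d hd => // d _.
pose B := delta ^+ 2 / d.+2%:R.
have B0 : 0 < B by rewrite divr_gt0 ?exprn_gt0 ?ltr0n.
have BE : B * d.+2%:R = delta ^+ 2 by rewrite divfK // pnatr_eq0.
have [ss [rhos [zetas [k [[sz1 sz2 sz3] [u1 u2 u3] [k0 kB] [b1 b2]
  [gap b3]]]]]] :=
  small_parameters n B0.
pose g := sys_g d n ss k; pose c := @sys_c R d n rhos zetas.
have rg : radial g by exact: radial_sys_g.
have rc l : radial (c l) by exact: radial_sys_c.
exists (radial_sys g c); split.
- by split; exact: deg_le_sys_g hn sz1 _.
- by move=> l; exact: (deg_le_sys_c sz2 sz3).
- by split; apply: no_pure_z_var_mul; [left|right].
pose T := zero_index d n ss rhos k.
have cardT : ncycles d.+1 n = #|T| by rewrite card_zero_index.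
pose idx (i : 'I_(ncycles d.+1 n)) : T := enum_val (cast_ord cardT i).
have idx_inj : injective idx by move=> i j /enum_val_inj /cast_ord_inj.
pose zero i := zero_of zetas (idx i).
have zero_inj : injective zero.
  by apply: inj_comp idx_inj; exact: (zero_of_inj sz3 u1 u2 u3 kB b1 b2 gap).
have zero_gt0 i : 0 < rcoord (zero i).
  exact: (zero_of_gt0 zetas kB b1 b2 gap).
have zero_cnd i : zero_cond n ss rhos zetas k (zero i).
  exact: (zero_of_cond sz3 kB b1 b2 gap).
exists zero; split=> //.
  apply/seteqP; split=> [_ [i _ <-]|p [sp p0]] /=.
    by split=> //; apply: (iffRL (zero_condP n u1 u2 u3 k0 gap (zero_gt0 i))).
  have zp := iffLR (zero_condP n u1 u2 u3 k0 gap p0) sp.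
  have [t <-] := zero_of_surj sz3 kB b1 b2 gap p0 zp.
  exists (cast_ord (esym cardT) (enum_rank t)) => //.
  by rewrite /zero /idx cast_ordKV enum_rankK.
(* The circles are invariant for every eps: the limit cycles do not move. *)
exists (fun i _ => circle_of (zero i)), 1; split=> // [eps /andP[eps0 _]|i].
  split=> [i|i j /eqP ij|i u].
  - apply: nondegenerate_limit_cycle => //; last by rewrite -normr_gt0.
    exact: (zero_cond_nondegenerate u1 u2 u3 k0 gap).
  - by move=> /circle_inj eij; apply/ij/zero_inj/eij.
  - have [rB zB] := zero_ofB sz3 kB b1 b2 gap b3 (idx i).
    exact: circle_in_ball BE rB zB.
move=> eta eta0; near=> eps.
by split=> u cu; exists u => //; rewrite subrr normr0.
Unshelve. all: by end_near.
Qed.
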